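(* Let $h\ge 1$, let $n_1<\ldots<n_h$ be positive integers, and let $a_1,\ldots,a_h$ be integers. Consider the Diophantine equation $$\sum_{\ell=1}^h a_\ell\, x_\ell^{n_\ell}=0$$ in the unknowns $x_1,\ldots,x_h$. If all coefficients $a_\ell$ are odd, and $h$ is odd, then the equation is not partition regular on $\mathbb{N}$.
   Context: $\mathbb{N}$ denotes the set of positive integers. An equation $f(x_1,\ldots,x_n)=0$ is partition regular on $\mathbb{N}$ if for every finite coloring (partition) $\mathbb{N}=C_1\cup\ldots\cup C_r$ there exist an index $i$ and elements $a_1,\ldots,a_n\in C_i$ (not necessarily distinct) with $f(a_1,\ldots,a_n)=0$. *)

(* Defs.v *)
From mathcomp Require Import all_boot all_order all_algebra.

Set Implicit Arguments.
Unset Strict Implicit.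
Unset Printing Implicit Defensive.

Import GRing.Theory.
Local Open Scope ring_scope.

(* A partition of the positive integers into r classes is given by a map
   c : nat -> 'I_r; the value c 0 is irrelevant, since only positive
   unknowns are allowed. *)
Definition partition_regular (n : nat) (f : ('I_n -> int) -> int) : Prop :=
  forall (r : nat) (c : nat -> 'I_r),
  exists (k : 'I_r) (x : 'I_n -> nat),
    [/\ forall i : 'I_n, (0 < x i)%N,
        forall i : 'I_n, c (x i) = k
      & f (fun i => (x i)%:Z) = 0].

(* Main.v *)
Require Import Defs.
From mathcomp Require Import all_boot all_order all_algebra zify.

(** The 2-adic valuation v decides everything.  The term a x^n, with a odd,
    has valuation n v(x), and a sum of nonzero integers is nonzero as soon as
    the smallest valuation is attained by an odd number of terms
    ([sum_neq0_odd_min_log2]): dividing by that power of 2 leaves an odd sum.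
    A colouring is wanted under which this happens for every monochromatic x.

    The first component of the colour of x is its parity.  If all x_l are odd,
    then all terms have valuation 0, and their number h is odd.  If all x_l are
    even, it is enough that the minimum be attained only once, so n_l v(x_l)
    and n_m v(x_m) must differ for l <> m.  Since v(x_l) and v(x_m) are now
    positive, equality would force their ratio to be one of the finitely many
    numbers n_m / n_l, none of which is 1.  A finite colouring of the positive
    integers avoids any finite set of ratios other than 1: colour v by its
    p-adic valuations, for the primes p < N, reduced modulo N, where N exceeds every
    exponent ([eq_factor_of_log_mod]).  The ratio of two distinct exponents
    involves only primes below N, with multiplicities smaller than N in absolute
    value and not all zero, so multiplying by it changes the colour. *)

Set Implicit Arguments.
Unset Strict Implicit.
Unset Printing Implicit Defensive.

Import GRing.Theory.
Local Open Scope ring_scope.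

Lemma odd_abszD (y z : int) : odd `|(y + z)%R|%N = odd `|y|%N (+) odd `|z|%N.
Proof. lia. Qed.

Lemma odd_absz_sum (I : finType) (w : I -> int) :
  odd `|(\sum_i w i)%R|%N = odd #|[pred i | odd `|w i|%N]|.
Proof.
have odd0 : odd `|0 : int|%N = false by [].
rewrite (big_morph (fun z : int => odd `|z|%N) odd_abszD odd0).
rewrite -sum1_card (big_morph odd oddD (erefl : odd 0 = false)) [RHS]big_mkcond.
by apply: eq_bigr => i _; rewrite inE; case: ifP.
Qed.

Lemma odd_div_expn2 (m e : nat) :
  (0 < m)%N -> (e <= logn 2 m)%N -> odd (m %/ 2 ^ e) = (logn 2 m == e).
Proof.
move=> m_gt0 le_e.
have dv : (2 ^ e %| m)%N by rewrite pfactor_dvdn.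
have q_gt0 : (0 < m %/ 2 ^ e)%N by rewrite divn_gt0 ?expn_gt0 // dvdn_leq.
rewrite -[odd _]negbK -dvdn2 -[X in (X %| _)%N]expn1 pfactor_dvdn //.
by rewrite logn_div // pfactorK // -leqNgt leqn0 subn_eq0 eqn_leq le_e andbT.
Qed.

(** After division by 2^e the terms of valuation e become odd and all others
    even, so the quotient of the sum is odd. *)
Lemma sum_neq0_odd_min_log2 (I : finType) (u : I -> int) (e : nat) :
    (forall i, u i != 0) -> (forall i, (e <= logn 2 `|u i|)%N) ->
    odd #|[pred i | logn 2 `|u i|%N == e]| ->
  \sum_i u i != 0.
Proof.
move=> u_neq0 le_e; apply: contraTneq => sum0.
have dv i : ((2 ^ e)%N%:Z %| u i)%Z.
  by rewrite dvdzE pfactor_dvdn // absz_gt0.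
have qE : \sum_i (u i %/ (2 ^ e)%N%:Z)%Z = 0.
  have /mulIf : (2 ^ e)%N%:Z != 0 by rewrite -absz_gt0 expn_gt0.
  apply; rewrite mul0r mulr_suml -[RHS]sum0.
  by apply: eq_bigr => i _; rewrite divzK.
have := odd_absz_sum (fun i => u i %/ (2 ^ e)%N%:Z)%Z; rewrite qE /= => odd0.
rewrite (_ : #|_| = #|[pred i | odd `|(u i %/ (2 ^ e)%N%:Z)%Z|%N]|) -?odd0 //.
apply: eq_card => i; rewrite !inE -odd_div_expn2 ?absz_gt0 //.
by congr odd; rewrite -{1}(divzK (dv i)) abszM mulnK // expn_gt0.
Qed.

(** For p < N, the p-adic valuation of v/w = m/n is divisible by N, by the
    congruence, and smaller than N in absolute value, as a difference of
    valuations of m and n; so it vanishes.  Primes from N on divide neither m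
    nor n. *)
Lemma eq_factor_of_log_mod (N n m v w : nat) :
    (0 < n < N)%N -> (0 < m < N)%N -> (0 < v)%N -> (0 < w)%N ->
    (forall p : nat, (p < N)%N -> logn p v = logn p w %[mod N]) ->
  (n * v = m * w)%N -> n = m.
Proof.
move=> /andP[n_gt0 n_lt] /andP[m_gt0 m_lt] v_gt0 w_gt0 col_vw nv_mw.
apply: eqn_from_log => // p.
have [le_Np | lt_pN] := leqP N p.
  by rewrite !ltn_log0 //; apply: leq_trans le_Np.
have log_lt k : (0 < k)%N -> (k < N)%N -> (logn p k < N)%N.
  by move=> k_gt0; apply: ltn_trans; apply: ltn_logl.
rewrite -(modn_small (log_lt _ n_gt0 n_lt)) -(modn_small (log_lt _ m_gt0 m_lt)).
apply/eqP; rewrite -(eqn_modDr (logn p v)) -lognM // nv_mw lognM //.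
by rewrite eqn_modDl (col_vw _ lt_pN).
Qed.

Lemma log2_monomial (a : int) (x n : nat) :
  odd `|a|%N -> (0 < x)%N ->
  logn 2 `|(a * x%:Z ^+ n)%R|%N = (n * logn 2 x)%N.
Proof.
move=> a_odd x_gt0.
by rewrite abszM abszX /= logn_Gauss ?lognX // coprime2n.
Qed.

Theorem theorem2p11 (h : nat) (n : 'I_h -> nat) (a : 'I_h -> int)
  (h_ge1 : (1 <= h)%N)
  (n_gt0 : forall l : 'I_h, (0 < n l)%N)
  (n_incr : forall l m : 'I_h, (l < m)%N -> (n l < n m)%N)
  (a_odd : forall l : 'I_h, odd `|a l|%N)
  (h_odd : odd h) :
  ~ partition_regular (fun x : 'I_h -> int => \sum_(l < h) a l * x l ^+ n l).
Proof.
have n_inj : injective n.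
  move=> l m eq_n; apply: val_inj.
  by case: (ltngtP (val l) (val m)) => // /n_incr; rewrite eq_n ltnn.
pose N := (\max_l n l).+1%N.
have n_lt l : (0 < n l < N)%N by rewrite n_gt0 ltnS leq_bigmax.
pose col (x : nat) : bool * {ffun 'I_N -> 'I_N} :=
  (odd x, [ffun p : 'I_N => inord (logn p (logn 2 x) %% N)%N]).
move=> /(_ _ (fun x => enum_rank (col x))) [k [x [x_gt0 x_col]]].
have {k x_col} col_x l m : col (x l) = col (x m).
  by apply: enum_rank_inj; rewrite !x_col.
pose u l := a l * (x l)%:Z ^+ n l; apply/eqP; rewrite -/(\sum_l u l).
have log_u l : logn 2 `|u l|%N = (n l * logn 2 (x l))%N.
  exact: log2_monomial.
have u_neq0 l : u l != 0.
  rewrite mulf_neq0 ?expf_neq0 -?absz_gt0 //; last exact: x_gt0.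
  exact: odd_gt0.
pose l0 := Ordinal h_ge1.
have odd_x l : odd (x l) = odd (x l0) by case: (col_x l l0).
case: (boolP (odd (x l0))) => [x0_odd | x0_even].
  have log_u0 l : logn 2 `|u l|%N = 0%N.
    by rewrite log_u [logn 2 (x l)]logn_coprime ?muln0 // coprime2n odd_x.
  apply: (@sum_neq0_odd_min_log2 _ u 0) => //.
  by rewrite (eq_card (B := 'I_h)) ?card_ord // => l; rewrite !inE log_u0.
(* All x l are even, so distinct terms have distinct valuations and the
   minimum is attained once. *)
have v_gt0 l : (0 < logn 2 (x l))%N.
  by rewrite logn_gt0 mem_primes x_gt0 dvdn2 odd_x.
have log_u_inj l m : logn 2 `|u l|%N = logn 2 `|u m|%N -> l = m.
  rewrite !log_u => eq_log; apply: n_inj.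
  apply: (@eq_factor_of_log_mod N) eq_log => // p lt_pN.
  have [_ /ffunP/(_ (Ordinal lt_pN))] := col_x l m.
  by rewrite !ffunE => /(congr1 val); rewrite /= !inordK ?ltn_mod.
case: (@arg_minnP _ l0 predT (fun l => logn 2 `|u l|%N)) => // m _ min_m.
apply: (@sum_neq0_odd_min_log2 _ u (logn 2 `|u m|%N)) => // [l | ].
  exact: min_m.
rewrite (eq_card (B := pred1 m)) ?card1 // => l; rewrite !inE.
by apply/eqP/eqP => [/log_u_inj | ->].
Qed.
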